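(* Let $(A,\mathfrak m)$ be a nonzero commutative local ring and let $R=\mathcal T(A)$. The maximal spectrum $\mathrm{Max}\,R$ is homeomorphic to the one-point compactification of the discrete space $\mathbb N$, with $M_\infty$ corresponding to the added point. If $A$ is a local domain which is not a field, then the minimal prime spectrum $\mathrm{Min}\,R$ is an infinite discrete, non-quasi-compact space.
   Context: All rings are commutative with identity. For a nonzero local ring $(A,\mathfrak m)$ (not necessarily Noetherian) with residue field $\kappa=A/\mathfrak m$ and residue map $a\mapsto\bar a$, define the ring, with coordinatewise operations, $$\mathcal T(A)=\{(a,(c_i)_{i\in\mathbb N})\in A\times\kappa^{\mathbb N}: c_i=\bar a\text{ for all but finitely many }i\},\quad \mathbb N=\{1,2,\ldots\}.$$ $\pi:\mathcal T(A)\to A$ is the projection $(a,(c_i))\mapsto a$, and $M_\infty=\pi^{-1}(\mathfrak m)$. $\mathrm{Max}\,R$ and $\mathrm{Min}\,R$ denote the sets of maximal ideals and of minimal prime ideals of $R$, with the subspace topologies from the Zariski topology on $\mathrm{Spec}\,R$. *)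

(* Defs.v *)
From HB Require Import structures.
From mathcomp Require Import all_boot all_order all_algebra.
From mathcomp Require Import generic_quotient ring_quotient.
From mathcomp Require Import all_classical.
From mathcomp Require Import topology.

Set Implicit Arguments.
Unset Strict Implicit.
Unset Printing Implicit Defensive.

Import GRing.Theory.
Local Open Scope ring_scope.
Local Open Scope quotient_scope.
Local Open Scope classical_set_scope.

Definition homeomorphism (X Y : topologicalType) (f : X -> Y) : Prop :=
  continuous f /\
  exists g : Y -> X, [/\ cancel f g, cancel g f & continuous g].

Definition discrete_space (X : topologicalType) : Prop :=
  forall U : set X, open U.

(** An [idealr R] is a proper ideal, so maximality is among proper ideals. *)

Definition maximal_ideal (R : comNzRingType) (I : idealr R) : Prop :=
  forall J : idealr R, {subset I <= J} -> {subset J <= I}.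

Definition local_ring (A : comNzRingType) (m : idealr A) : Prop :=
  maximal_ideal m /\ forall J : idealr A, maximal_ideal J -> J =i m.

Definition is_domain (A : comNzRingType) : Prop :=
  forall x y : A, x * y = 0 -> x = 0 \/ y = 0.

Definition is_field (A : comNzRingType) : Prop :=
  forall x : A, x != 0 -> exists y : A, x * y = 1.

Definition Spec (R : comNzRingType) : Type := prime_idealr R.

HB.instance Definition _ (R : comNzRingType) := gen_eqMixin (Spec R).
HB.instance Definition _ (R : comNzRingType) := gen_choiceMixin (Spec R).

Section Zariski.
Variable R : comNzRingType.

Definition spec_mem (P : Spec R) : {pred R} := (P : prime_idealr R).

Definition zeros (E : set R) : set (Spec R) :=
  [set P | forall x, E x -> x \in spec_mem P].

Definition zariski_open : set_system (Spec R) :=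
  [set U | exists E : set R, U = ~` zeros E].

Let zopenT : zariski_open setT.
Proof.
exists setT; apply/esym; rewrite -subTset => P _ /(_ 1 I).
by rewrite /spec_mem idealr1.
Qed.

Let zopenI : setI_closed zariski_open.
Proof.
move=> _ _ [E ->] [F ->].
exists [set z | exists x y, [/\ E x, F y & z = x * y]].
rewrite -setCU; congr (~` _); apply/seteqP; split=> P /=.
  case=> [PE _ [x [y [Ex _ ->]]]|PF _ [x [y [_ Fy ->]]]].
    by rewrite mulrC; exact/idealMr/PE.
  exact/idealMr/PF.
move=> PEF; have [PE|] := pselect (zeros E P); first by left.
move=> /existsNP[x /not_implyP[Ex /negP xP]]; right=> y Fy.
have : x * y \in spec_mem P by apply: PEF; exists x, y.
by rewrite /spec_mem prime_idealrM => /orP[xP'|//]; case/negP: xP.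
Qed.

Let zopenU (I : Type) (f : I -> set (Spec R)) :
  (forall i, zariski_open (f i)) -> zariski_open (\bigcup_i f i).
Proof.
move=> /choice[E fE]; exists (\bigcup_i E i).
under eq_bigcupr do rewrite fE.
rewrite -setC_bigcap; congr (~` _); apply/seteqP; split=> P /=.
  by move=> PE x [i _ Eix]; exact: (PE i).
by move=> PE i _ x Eix; apply: PE; exists i.
Qed.

HB.instance Definition _ :=
  @isOpenTopological.Build (Spec R) zariski_open zopenT zopenI zopenU.

(** As types, [Max] and [Min] carry the subspace topology of [Spec R]
    (instance on [set_type] in the library). *)
Definition Max : set (Spec R) := [set P | maximal_ideal (P : prime_idealr R)].

Definition Min : set (Spec R) :=
  [set P | forall Q : Spec R, {subset spec_mem Q <= spec_mem P} ->
           {subset spec_mem P <= spec_mem Q}].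

End Zariski.

Arguments Max R : clear implicits.
Arguments Min R : clear implicits.

(** The index set {1, 2, ...} is represented by [nat], [i] standing for i + 1. *)

Section TRing.
Variables (A : comNzRingType) (m : idealr A).

Definition residue_field : comNzRingType := {ideal_quot m}.

Definition residue (a : A) : residue_field := \pi_{ideal_quot m} a.

Definition tpred : {pred A * (nat -> residue_field)} :=
  [pred x | `[< finite_set [set i | x.2 i <> residue x.1] >]].

Let tpred_closed : subring_closed tpred.
Proof.
have finU (x y z : A * (nat -> residue_field)) : x \in tpred -> y \in tpred ->
    (forall i, x.2 i = residue x.1 -> y.2 i = residue y.1 ->
       z.2 i = residue z.1) -> z \in tpred.
  move=> /asboolP fx /asboolP fy xyz; apply/asboolP.
  have /sub_finite_set : [set i | z.2 i <> residue z.1] `<=`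
      [set i | x.2 i <> residue x.1] `|` [set i | y.2 i <> residue y.1].
    move=> i /= zi; apply: contrapT => /not_orP[/contrapT xi /contrapT yi].
    exact/zi/xyz.
  by apply; rewrite finite_setU.
split=> [|x y xT yT|x y xT yT].
- apply/asboolP; rewrite (_ : [set _ | _] = set0)//.
  by apply/seteqP; split=> i //=; apply; rewrite /residue rmorph1.
- apply: finU xT yT _ => i xi yi.
  have -> : (x - y).2 i = x.2 i - y.2 i by [].
  by rewrite xi yi /residue -rmorphB.
- apply: finU xT yT _ => i xi yi.
  by rewrite {1}/GRing.mul /= {1}/GRing.mul /= xi yi /residue -rmorphM.
Qed.

HB.instance Definition _ := GRing.isSubringClosed.Build
  (A * (nat -> residue_field))%type tpred tpred_closed.

Record tring := TRing { tring_val :> A * (nat -> residue_field); _ : tring_val \in tpred }.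

HB.instance Definition _ := [isSub for tring_val].
HB.instance Definition _ := [Choice of tring by <:].
HB.instance Definition _ := [SubChoice_isSubComNzRing of tring by <:].

Definition tproj (x : tring) : A := (tring_val x).1.

Definition Minfty : {pred tring} := [pred x | tproj x \in m].

End TRing.

Arguments Minfty {A} m.

(* Main.v *)
(** For an index [i] let [e_i] be the idempotent (0, delta_i). If a prime [P]
    of T(A) omits some [e_i], then [x] is in [P] iff [x e_i] is, and [x e_i]
    only sees the i-th coordinate of [x], so [P] is the kernel
    [Mcoord i] of that coordinate. Otherwise [P] contains the kernel of the
    projection to [A], which is the ideal generated by the [e_i], so [P] is the
    preimage of a prime of [A].

    Among maximal ideals only [Minf] is of the second kind. The elements of T(A)
    with finitely many zero coordinates, such as (1, 1_{N - C}), give the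
    neighbourhoods of [Minf], which are therefore cofinite. When [A] is a domain
    but not a field, the only possible minimal primes are the [Mcoord i] and the
    kernel of the projection. The former are isolated by [e_i], the latter by
    the diagonal image of a nonzero element of [m], which lies in every [Mcoord i]. *)

Require Import Defs.
From HB Require Import structures.
From mathcomp Require Import all_boot all_order all_algebra.
From mathcomp Require Import generic_quotient ring_quotient.
From mathcomp Require Import all_classical.
From mathcomp Require Import topology.

Set Implicit Arguments.
Unset Strict Implicit.
Unset Printing Implicit Defensive.

Import GRing.Theory.

Local Open Scope ring_scope.
Local Open Scope quotient_scope.
Local Open Scope classical_set_scope.

(** * Maximal and prime ideals, and their preimages under ring morphisms *)

Section Ideals.
Variables R S : comNzRingType.

Definition ideal_of (I : R -> bool) (hI : idealr_closed I) : idealr R :=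
  HB.pack I (isIdealr.Build R I hI).

Definition prime_of (I : idealr R) (hI : prime_idealr_closed I) : Spec R :=
  HB.pack_for (prime_idealr R) (I : R -> bool) (Idealr.class I)
    (isPrimeIdealrClosed.Build R I hI).

(** The packed axioms are propositions, so proof irrelevance leaves only the membership predicates
    to compare. *)
Lemma Spec_eq (P Q : Spec R) : spec_mem P =i spec_mem Q -> P = Q.
Proof.
case: P Q => [P cP] [Q cQ] /= PQ.
have {PQ} ePQ : P = Q by apply/funext => x; exact: PQ.
subst Q; congr PrimeIdealr.Pack.
case: cP cQ => [[a1] [a2] [a3] [a4]] [[b1] [b2] [b3] [b4]].
by rewrite (Prop_irrelevance a1 b1) (Prop_irrelevance a2 b2)
  (Prop_irrelevance a3 b3) (Prop_irrelevance a4 b4).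
Qed.

Lemma pred1_0_idealr_closed : idealr_closed (pred1 (0 : R)).
Proof.
split; rewrite ?inE ?eqxx// ?oner_eq0//.
by move=> a u v; rewrite !inE => /eqP-> /eqP->; rewrite mulr0 addr0.
Qed.

Definition zero_ideal : idealr R := ideal_of pred1_0_idealr_closed.

Lemma preim_idealr_closed (f : {rmorphism R -> S}) (I : idealr S) :
  idealr_closed (fun x => f x \in I).
Proof.
have E x : (x \in fun x => f x \in I) = (f x \in I) by [].
split=> [||a u v]; rewrite !E ?rmorph0 ?rmorph1 ?rpred0 ?idealr1//.
by move=> uI vI; rewrite rmorphD rmorphM rpredD// idealMr.
Qed.

Definition preim_ideal f I : idealr R := ideal_of (@preim_idealr_closed f I).

Lemma preim_idealE f I x : (x \in preim_ideal f I) = (f x \in I).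
Proof. by []. Qed.

Lemma maximal_ideal_inv (I : idealr R) : maximal_ideal I ->
  forall u, u \notin I -> exists a, 1 - a * u \in I.
Proof.
move=> maxI u uI; apply: contrapT => /forallNP nI.
(* [J] is [I + Ru]; it is proper when no [a] inverts [u] modulo [I], and maximality then puts [u] in
   [I]. *)
pose J x := `[< exists a, x - a * u \in I >].
have cJ : idealr_closed J.
  split.
  - by apply/asboolP; exists 0; rewrite mul0r subrr rpred0.
  - by apply/negP => /asboolP[a]; exact: nI.
  - move=> b x y /asboolP[a xa] /asboolP[c yc]; apply/asboolP.
    exists (b * a + c).
    rewrite (_ : _ - _ = b * (x - a * u) + (y - c * u)).
      by rewrite rpredD// idealMr.
    by rewrite mulrBr mulrDl opprD -!mulrA addrACA.
move/negP: uI; apply; apply: (maxI (ideal_of cJ)).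
  by move=> x xI; apply/asboolP; exists 0; rewrite mul0r subr0.
by apply/asboolP; exists 1; rewrite mul1r subrr rpred0.
Qed.

Lemma inv_maximal_ideal (I : idealr R) :
  (forall u, u \notin I -> exists a, 1 - a * u \in I) -> maximal_ideal I.
Proof.
move=> invI J IJ u uJ; apply/negPn/negP => /invI[a /IJ].
by rewrite rpredBr ?idealr1// idealMr.
Qed.

Lemma maximal_ideal_prime (I : idealr R) :
  maximal_ideal I -> prime_idealr_closed I.
Proof.
move=> maxI u v uv; apply/orP.
have [uI|/(maximal_ideal_inv maxI)[a au]] := boolP (u \in I).
  by left.
right; have := idealMr v au; rewrite mulrBr mulr1 mulrCA (mulrC v).
by rewrite rpredBr// idealMr.
Qed.

End Ideals.

Lemma preim_maximal_ideal (R S : comNzRingType) (f : {rmorphism R -> S})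
    (I : idealr S) :
  (forall y, exists x, f x = y) -> maximal_ideal I ->
  maximal_ideal (preim_ideal f I).
Proof.
move=> f_surj maxI; apply: inv_maximal_ideal => u.
rewrite preim_idealE => /(maximal_ideal_inv maxI)[b].
have [a <-] := f_surj b; exists a.
by rewrite preim_idealE rmorphB rmorphM rmorph1.
Qed.

Lemma preim_prime_ideal (R S : comNzRingType) (f : {rmorphism R -> S})
    (I : idealr S) :
  prime_idealr_closed I -> prime_idealr_closed (preim_ideal f I).
Proof.
by move=> pI u v; rewrite !preim_idealE rmorphM; exact: pI.
Qed.

(** * The residue field *)

Section Residue.
Variables (A : comNzRingType) (m : idealr A).

HB.instance Definition _ := GRing.RMorphism.copy (residue m)
  (\pi_{ideal_quot m} : A -> residue_field m).

Lemma residue_eq0 a : (residue m a == 0) = (a \in m).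
Proof.
by rewrite -{1}(rmorph0 (residue m)) /residue -Quotient.idealrBE subr0.
Qed.

Lemma residue_surj c : exists a, residue m a = c.
Proof. by exists (repr c); exact: reprK. Qed.

Lemma residue_field_inv : maximal_ideal m ->
  forall c : residue_field m, c != 0 -> exists d, d * c = 1.
Proof.
move=> maxm c; have [a <-] := residue_surj c.
rewrite residue_eq0 => /(maximal_ideal_inv maxm)[b].
rewrite -residue_eq0 rmorphB rmorphM rmorph1 subr_eq0 => /eqP e.
by exists (residue m b).
Qed.

Lemma residue_field_zero_maximal :
  maximal_ideal m -> maximal_ideal (zero_ideal (residue_field m)).
Proof.
move=> maxm; apply: inv_maximal_ideal => c /(residue_field_inv maxm)[d dc].
by exists d; rewrite dc subrr rpred0.
Qed.

End Residue.

(** * Coordinates, diagonal elements and idempotents of T(A) *)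

Section TRingTheory.
Variables (A : comNzRingType) (m : idealr A).
Local Notation T := (tring m).

Definition tcoord (i : nat) (x : T) : residue_field m := (tring_val x).2 i.

Fact tproj_zmod : zmod_morphism (@tproj A m).
Proof. by []. Qed.
Fact tproj_monoid : monoid_morphism (@tproj A m).
Proof. by []. Qed.
HB.instance Definition _ :=
  GRing.isZmodMorphism.Build T A (@tproj A m) tproj_zmod.
HB.instance Definition _ :=
  GRing.isMonoidMorphism.Build T A (@tproj A m) tproj_monoid.

Fact tcoord_zmod i : zmod_morphism (tcoord i).
Proof. by []. Qed.
Fact tcoord_monoid i : monoid_morphism (tcoord i).
Proof. by []. Qed.
HB.instance Definition _ i :=
  GRing.isZmodMorphism.Build T (residue_field m) (tcoord i) (tcoord_zmod i).
HB.instance Definition _ i :=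
  GRing.isMonoidMorphism.Build T (residue_field m) (tcoord i)
    (tcoord_monoid i).

Lemma tring_eq (x y : T) :
  tproj x = tproj y -> (forall i, tcoord i x = tcoord i y) -> x = y.
Proof.
move=> e1 e2; apply: val_inj; rewrite [LHS]surjective_pairing.
by rewrite [RHS]surjective_pairing; congr pair => //; apply/funext.
Qed.

Lemma tring_finite (x : T) :
  finite_set [set i | tcoord i x <> residue m (tproj x)].
Proof. by case: x => x xT; exact/asboolP. Qed.

Fact tmk_subproof (a : A) (c : nat -> residue_field m) :
  finite_set [set i | c i <> residue m a] -> (a, c) \in @tpred A m.
Proof. by move=> fin; apply/asboolP. Qed.

Definition tmk a c fin : T := TRing (@tmk_subproof a c fin).

Fact tdiag_subproof a : finite_set [set _ : nat | residue m a <> residue m a].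
Proof. by rewrite (_ : [set _ | _] = set0)// -subset0 => i /=. Qed.

(** This ring morphism splits [tproj], so that ideals containing all the idempotents can be studied
    inside [A]. *)
Definition tdiag (a : A) : T := tmk (tdiag_subproof a).

Lemma tproj_diag a : tproj (tdiag a) = a. Proof. by []. Qed.

Lemma tcoord_diag i a : tcoord i (tdiag a) = residue m a. Proof. by []. Qed.

Fact tdiag_zmod : zmod_morphism tdiag.
Proof.
move=> a b; apply: tring_eq => [|i].
  by rewrite rmorphB !tproj_diag.
by rewrite rmorphB /= !tcoord_diag rmorphB.
Qed.
Fact tdiag_monoid : monoid_morphism tdiag.
Proof.
split=> [|a b]; apply: tring_eq => [|i].
- by rewrite tproj_diag rmorph1.
- by rewrite tcoord_diag !rmorph1.
- by rewrite rmorphM /= !tproj_diag.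
- by rewrite rmorphM /= !tcoord_diag rmorphM.
Qed.
HB.instance Definition _ := GRing.isZmodMorphism.Build A T tdiag tdiag_zmod.
HB.instance Definition _ :=
  GRing.isMonoidMorphism.Build A T tdiag tdiag_monoid.

Fact tidem_subproof (i : nat) :
  finite_set [set j : nat | (j == i)%:R <> residue m 0].
Proof.
apply: (@sub_finite_set _ _ [set i]) => // j /=; rewrite rmorph0.
by have [->|ji /(_ erefl)] := eqVneq j i.
Qed.

Definition tidem (i : nat) : T := tmk (tidem_subproof i).

Lemma tproj_idem i : tproj (tidem i) = 0. Proof. by []. Qed.

Lemma tcoord_idem j i : tcoord j (tidem i) = (j == i)%:R. Proof. by []. Qed.

Lemma tidemM i x a : tcoord i x = residue m a ->
  x * tidem i = tdiag a * tidem i.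
Proof.
move=> xi; apply: tring_eq => [|j].
  by rewrite !rmorphM /= tproj_idem !mulr0.
rewrite !rmorphM /= tcoord_idem tcoord_diag.
by case: (eqVneq j i) => [->|]; rewrite ?mulr0// xi.
Qed.

Lemma tproj_surj a : exists x : T, tproj x = a.
Proof. by exists (tdiag a); rewrite tproj_diag. Qed.

Lemma tcoord_surj i c : exists x : T, tcoord i x = c.
Proof.
have [a <-] := residue_surj c.
by exists (tdiag a); rewrite tcoord_diag.
Qed.

(** An element with zero projection has finitely many nonzero coordinates. Induction on their
    number: subtracting [x * tidem i], which lies in [I], erases the coordinate [i]. *)
Lemma ker_tproj_sub (I : idealr T) (x : T) :
  (forall i, tidem i \in I) -> tproj x = 0 -> x \in I.
Proof.
move=> eI x0; have /finite_setP[n] := tring_finite x.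
elim: n x x0 => [|n IH] x x0.
  rewrite x0 rmorph0 II0 card_eq0 => /eqP x_eq0.
  suff -> : x = 0 by rewrite rpred0.
  apply: tring_eq => [|i]; rewrite ?x0 ?rmorph0//.
  by apply: contrapT => xi; have : set0 i by rewrite -x_eq0.
rewrite x0 rmorph0 => /eq_cardSP[i /= xi Dn].
have xe : x * tidem i \in I by rewrite idealMr.
have y0 : tproj (x - x * tidem i) = 0.
  by rewrite rmorphB rmorphM /= tproj_idem mulr0 subr0.
have yE j : tcoord j (x - x * tidem i) = if j == i then 0 else tcoord j x.
  rewrite rmorphB rmorphM /= tcoord_idem.
  by case: (eqVneq j i) => _; rewrite ?mulr1 ?subrr// mulr0 subr0.
rewrite -(rpredBr _ xe); apply: IH => //; rewrite y0 rmorph0.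
rewrite (_ : [set _ | _] = [set i | tcoord i x <> 0] `\ i)//.
apply/seteqP; split=> j /=; rewrite yE; first by case: eqP.
by case=> xj /eqP/negPf ->.
Qed.

Lemma tring_diag_sub (I : idealr T) (x : T) :
  (forall i, tidem i \in I) -> (x \in I) = (tdiag (tproj x) \in I).
Proof.
move=> eI; have xI : x - tdiag (tproj x) \in I.
  by apply: ker_tproj_sub => //; rewrite rmorphB /= tproj_diag subrr.
by rewrite -{1}(subrK (tdiag (tproj x)) x) rpredDl.
Qed.

(** * Primes omitting an idempotent, and maximal ideals containing all of them *)

Section Maximal.
Hypothesis maxm : maximal_ideal m.

Definition Mcoord_ideal (i : nat) : idealr T :=
  preim_ideal (tcoord i) (zero_ideal (residue_field m)).

Lemma Mcoord_maximal i : maximal_ideal (Mcoord_ideal i).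
Proof.
apply: preim_maximal_ideal (tcoord_surj i) _.
exact: residue_field_zero_maximal.
Qed.

Definition Mcoord i : Spec T :=
  prime_of (maximal_ideal_prime (@Mcoord_maximal i)).

Lemma mem_Mcoord i x : (x \in spec_mem (Mcoord i)) = (tcoord i x == 0).
Proof. by []. Qed.

Definition Minf_ideal : idealr T := preim_ideal (@tproj A m) m.

Lemma Minf_maximal : maximal_ideal Minf_ideal.
Proof. exact: preim_maximal_ideal tproj_surj _. Qed.

Definition Minf : Spec T := prime_of (maximal_ideal_prime (@Minf_maximal)).

Lemma mem_Minf x : (x \in spec_mem Minf) = (tproj x \in m).
Proof. by []. Qed.

Lemma idem_Mcoord i j : (tidem j \in spec_mem (Mcoord i)) = (i != j).
Proof.
rewrite mem_Mcoord tcoord_idem.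
by case: (eqVneq i j) => _; rewrite ?oner_eq0 ?eqxx.
Qed.

Lemma Spec_idemN (P : Spec T) i : tidem i \notin spec_mem P -> P = Mcoord i.
Proof.
move=> eP; apply: Spec_eq => x; rewrite mem_Mcoord.
have -> : (x \in spec_mem P) = (x * tidem i \in spec_mem P).
  by rewrite prime_idealrM (negPf eP) orbF.
(* Only the coordinate [i] survives multiplication by [tidem i], so a lift [a] of that coordinate
   can replace [x]. *)
have [a xa] := residue_surj (tcoord i x); rewrite (tidemM (esym xa)) -xa.
have [a0|/(residue_field_inv maxm)[d]] := eqVneq (residue m a) 0.
  rewrite (_ : _ * _ = 0) ?rpred0//.
  apply: tring_eq => [|j]; rewrite rmorphM /= ?tproj_idem ?mulr0 ?rmorph0//.
  by rewrite tcoord_diag a0 mul0r.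
have [b <-] := residue_surj d; rewrite -rmorphM => ba1.
apply: contraNF eP => aP.
(* Here [b] lifts an inverse of the residue of [a], so [tidem i] is a multiple of
   [tdiag a * tidem i] and would be in [P] along with it. *)
have -> : tidem i = tdiag b * (tdiag a * tidem i).
  by rewrite mulrA -rmorphM -(@tidemM i 1) ?mul1r// rmorph1.
exact: idealMr.
Qed.

(** The contraction of [P] along [tdiag] is maximal, hence [m]. As [tdiag] is not onto, an inverse
    [y] modulo [P] is first moved to the diagonal: [P] does not distinguish [y] from
    [tdiag (tproj y)]. *)
Lemma Spec_maximal_idem (P : Spec T) :
    (forall J : idealr A, maximal_ideal J -> J =i m) ->
    maximal_ideal (P : prime_idealr T) -> (forall i, tidem i \in spec_mem P) ->
  P = Minf.
Proof.
move=> uniqm maxP eP; apply: Spec_eq => x; rewrite mem_Minf.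
suff <- : preim_ideal tdiag (P : prime_idealr T) =i m.
  by rewrite /spec_mem tring_diag_sub.
apply: uniqm; apply: inv_maximal_ideal => u /(maximal_ideal_inv maxP)[y].
rewrite tring_diag_sub// => yP; exists (tproj y).
by rewrite preim_idealE; move: yP; congr (tdiag _ \in _).
Qed.

End Maximal.
End TRingTheory.

(** * Compact subsets of discrete spaces, and Zariski neighbourhoods *)

Lemma compact_discrete_finite (X : topologicalType) (C : set X) :
  discrete_space X -> compact C -> finite_set C.
Proof.
move=> discX cC; apply: contrapT => infC.
(* The filter of sets cofinite in [C], proper when [C] is infinite. A cluster point [p] is
   impossible: [F] contains the complement of the open set [[set p]]. *)
pose F := [set B : set X | finite_set (C `\` B)].
have FF : ProperFilter F.
  apply: Build_ProperFilter_ex.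
    move=> B FB; apply: contrapT => /forallNP nB; apply: infC.
    by apply: sub_finite_set FB => x Cx; split => // /nB.
  split.
  - by rewrite /F /= setDT.
  - by move=> B D FB FD; rewrite /F /= setDIr finite_setU.
  - by move=> B D BD; apply: sub_finite_set; exact: setDS.
have [|p [Cp clp]] := cC F FF; first by rewrite /F /= setDv.
have Fp : F (~` [set p]).
  by apply: (@sub_finite_set _ _ [set p]) => // x [_ /contrapT].
have [|x [xp /xp]//] := clp _ [set p] Fp.
by apply: open_nbhs_nbhs; split => //; exact: discX.
Qed.

Section SpecTopology.
Variables (R : comNzRingType) (B : set (Spec R)).

(** The sets of primes omitting one given element form a base: a prime outside [zeros E] omits some
    [x] in [E], and every prime omitting [x] is outside [zeros E] too. *)
Lemma nbhs_Spec_sub (M : B) (V : set B) :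
  nbhs M V <-> exists2 x, x \notin spec_mem (set_val M) &
    forall N : B, x \notin spec_mem (set_val N) -> V N.
Proof.
split; last first.
  case=> x xM xV; rewrite nbhsE.
  exists [set N : B | x \notin spec_mem (set_val N)] => //.
  split => //; exists (~` zeros [set x]); first by exists [set x].
  apply/seteqP; split=> N /=.
    by move=> nx; apply/negP => xN; apply: nx => _ ->.
  by move=> /negP xN /(_ x erefl).
rewrite nbhsE => -[W [[O oO <-] OM] WV]; have [E OE] := oO; move: OM.
rewrite OE /= => /existsNP[x /not_implyP[Ex /negP xM]].
exists x => // N /negP xN; apply: WV => /=; rewrite OE => zN.
exact/xN/zN.
Qed.

End SpecTopology.

(** * The homeomorphism between Max T(A) and the one-point compactification *)

Section MaxSpace.
Variables (A : comNzRingType) (m : idealr A).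
Hypothesis Aloc : local_ring m.
Local Notation T := (tring m).

Definition Max_point (o : one_point_compactification nat) : Max T :=
  if o is Some i
  then exist _ (Mcoord Aloc.1 i) (mem_set (@Mcoord_maximal A m Aloc.1 i))
  else exist _ (Minf Aloc.1) (mem_set (@Minf_maximal A m Aloc.1)).

Lemma idem_Minf i : tidem m i \in spec_mem (Minf Aloc.1).
Proof. by rewrite (mem_Minf Aloc.1) tproj_idem rpred0. Qed.

Lemma Max_point_Some (M : Max T) i :
  tidem m i \notin spec_mem (set_val M) -> M = Max_point (Some i).
Proof. by move=> /(Spec_idemN Aloc.1) Mi; exact: val_inj. Qed.

(** The idempotent [tidem m i] is omitted by the ideal at [Some i] and by no other. *)
Lemma Max_point_inj : injective Max_point.
Proof.
have cN i o : Max_point (Some i) = Max_point o -> o = Some i.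
  move=> /(congr1 (fun N : Max T => tidem m i \in spec_mem (set_val N))) /=.
  rewrite (idem_Mcoord Aloc.1) eqxx.
  case: o => [j|]/=; last by rewrite idem_Minf.
  by rewrite (idem_Mcoord Aloc.1); have [->|] := eqVneq j i.
by case=> [i|] o; [move=> /cN|case: o => // j /esym/cN].
Qed.

Lemma Max_point_surj (M : Max T) : exists o, Max_point o = M.
Proof.
have [[i iM]|/forallNP eM] :=
  pselect (exists i, tidem m i \notin spec_mem (set_val M)).
  by exists (Some i); rewrite -(Max_point_Some iM).
exists None; apply: val_inj; apply/esym; apply: Spec_maximal_idem Aloc.2 _ _.
  by case: M {eM} => M /= /set_mem.
by move=> i; apply/negPn/negP/eM.
Qed.

Definition Max_index (M : Max T) : one_point_compactification nat :=
  sval (cid (Max_point_surj M)).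

Lemma Max_indexK : cancel Max_index Max_point.
Proof. by move=> M; exact: (svalP (cid (Max_point_surj M))). Qed.

Lemma Max_pointK : cancel Max_point Max_index.
Proof. by move=> o; apply: Max_point_inj; rewrite Max_indexK. Qed.

Lemma Max_point_continuous : continuous Max_point.
Proof.
case=> [i|] V /=; first by move=> /nbhs_singleton Vi; exact/principal_filterP.
move=> /nbhs_Spec_sub[x]; rewrite /= (mem_Minf Aloc.1) => xm xV.
(* The residue of [tproj x] is nonzero, so a zero coordinate is one of the finitely many that differ
   from it. *)
exists [set i | tcoord i x = 0].
  split; last exact: discrete_closed.
  apply: finite_compact; apply: sub_finite_set (tring_finite x) => i /= ->.
  by move=> /esym/eqP; rewrite residue_eq0 (negPf xm).
move=> _ [[i xi <-]|->] /=; apply: xV => /=; last by rewrite (mem_Minf Aloc.1).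
rewrite (mem_Mcoord Aloc.1).
exact/eqP.
Qed.

Lemma Max_index_continuous : continuous Max_index.
Proof.
move=> M; rewrite -(Max_indexK M); case: (Max_index M) => [i|] U.
  rewrite Max_pointK => /nbhs_singleton Ui; apply/nbhs_Spec_sub.
  exists (tidem m i); first by rewrite /= (idem_Mcoord Aloc.1) eqxx.
  by move=> N /Max_point_Some ->; rewrite -[(_ @^-1` _) _]/(U _) Max_pointK.
rewrite Max_pointK => -[C [cC _] CU].
(* The compact set [C] is finite, so coordinates 0 on [C] and 1 elsewhere, with projection 1, define
   an element. [Minf] omits it, and [Mcoord i] contains it when [i] is in [C]. *)
have finC : finite_set [set i | (i \notin C)%:R <> residue m 1].
  apply: sub_finite_set (compact_discrete_finite (@discrete_open _) cC) => i /=.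
  rewrite rmorph1 => iC; apply/set_mem/negPn/negP => niC.
  by apply: iC; rewrite niC.
apply/nbhs_Spec_sub; exists (tmk finC).
  by rewrite /= (mem_Minf Aloc.1) /tproj /= idealr1.
move=> N; rewrite -[N]Max_indexK; set o := Max_index N => oN.
rewrite -[(_ @^-1` _) _]/(U _) Max_pointK; apply: CU.
case: o oN => [i|] /= oN; [left|by right].
exists i => // Ci; move: oN.
by rewrite (mem_Mcoord Aloc.1) /tcoord /= (mem_set Ci) eqxx.
Qed.

End MaxSpace.

(** * Minimal primes over a local domain that is not a field *)

Section MinSpace.
Variables (A : comNzRingType) (m : idealr A).
Hypothesis maxm : maximal_ideal m.
Hypotheses (domA : is_domain A) (nfieldA : ~ is_field A).
Local Notation T := (tring m).

(** A prime inside [Mcoord i] also omits [tidem m i], and that determines it. *)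
Lemma Mcoord_minimal i : Min T (Mcoord maxm i).
Proof.
move=> Q QM; rewrite (@Spec_idemN _ _ maxm Q i)//.
by apply/negP => /QM; rewrite (idem_Mcoord maxm) eqxx.
Qed.

Lemma zero_ideal_prime : prime_idealr_closed (zero_ideal A).
Proof.
move=> u v /eqP/domA[->|->]; apply/orP; [left|right]; exact: rpred0.
Qed.

Definition ker_tproj : Spec T :=
  prime_of (preim_prime_ideal (f := @tproj A m) zero_ideal_prime).

Lemma mem_ker_tproj x : (x \in spec_mem ker_tproj) = (tproj x == 0).
Proof. by []. Qed.

(** If [m] were zero, inverses modulo [m] would be inverses in [A]. *)
Lemma maximal_ideal_neq0 : exists2 a, a \in m & a != 0.
Proof.
apply: contrapT => m0; apply: nfieldA => x x0.
have [|a] := maximal_ideal_inv maxm (u := x).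
  by apply: contra_notN m0 => xm; exists x.
have [ax1|ax0 axm] := eqVneq (1 - a * x) 0.
  by exists a; rewrite mulrC; apply/esym/eqP; rewrite -subr_eq0 ax1.
by case: m0; exists (1 - a * x).
Qed.

Lemma Min_classification (P : Spec T) : Min T P ->
  P = ker_tproj \/ exists i, P = Mcoord maxm i.
Proof.
move=> minP.
have [[i iP]|/forallNP eP] := pselect (exists i, tidem m i \notin spec_mem P).
  by right; exists i; exact: Spec_idemN.
have {}eP i : tidem m i \in spec_mem P by apply/negPn/negP/eP.
(* Containing every idempotent, [P] contains [ker_tproj], which is prime as [A] is a domain;
   minimality of [P] gives equality. *)
have KP : {subset spec_mem ker_tproj <= spec_mem P}.
  by move=> x /eqP; exact: (ker_tproj_sub (I := (P : prime_idealr T))).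
by left; apply: Spec_eq => x; apply/idP/idP => [/(minP _ KP)|/KP].
Qed.

Lemma Min_discrete : discrete_space (Min T).
Proof.
(* One basic open set that meets the space only in [M] makes [M] an isolated point. *)
suff isolated (M : Min T) : exists2 x, x \notin spec_mem (set_val M) &
    forall N : Min T, x \notin spec_mem (set_val N) -> set_val N = set_val M.
  move=> U; rewrite openE => M UM; apply/nbhs_Spec_sub.
  by have [x xM xN] := isolated M; exists x => // N /xN/val_inj ->.
have class (N : Min T) :
    set_val N = ker_tproj \/ exists i, set_val N = Mcoord maxm i.
  exact: Min_classification (set_valP N).
have [MK|[i Mi]] := class M.
  have [a am a0] := maximal_ideal_neq0.
  exists (tdiag m a) => [|N]; first by rewrite MK mem_ker_tproj tproj_diag.
  have [->|[i ->]] := class N; first by rewrite MK.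
  by rewrite (mem_Mcoord maxm) tcoord_diag residue_eq0 am.
exists (tidem m i); first by rewrite Mi (idem_Mcoord maxm) eqxx.
by move=> N /(Spec_idemN maxm) ->.
Qed.

Definition Min_point i : Min T := 
  exist _ (Mcoord maxm i) (mem_set (@Mcoord_minimal i)).

Lemma Min_infinite : infinite_set [set: Min T].
Proof.
move=> finMin; apply: infinite_nat.
rewrite -(preimage_setT Min_point); apply: finite_preimage finMin.
(* Testing membership of [tidem m i] recovers the index, so [Min_point] is injective. *)
move=> i j _ _ /(congr1 (fun N : Min T => tidem m i \in spec_mem (set_val N))).
by rewrite /= !(idem_Mcoord maxm) eqxx => /esym/negbFE/eqP.
Qed.

End MinSpace.

Theorem proposition4p4 (A : comNzRingType) (m : idealr A)
    (Aloc : local_ring m) :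
  (exists f : Max (tring m) -> one_point_compactification nat,
     homeomorphism f /\
     forall M : Max (tring m),
       f M = None <-> spec_mem (set_val M) =i Minfty m) /\
  (is_domain A -> ~ is_field A ->
     [/\ infinite_set [set: Min (tring m)],
         discrete_space (Min (tring m)) &
         ~ compact [set: Min (tring m)]]).
Proof.
split; last first.
  move=> domA nfieldA; have discM := Min_discrete Aloc.1 domA nfieldA.
  have infM := Min_infinite (m := m) Aloc.1.
  (* Compactness of a discrete space would force finiteness, against [infM]. *)
  by split=> // /(compact_discrete_finite discM).
exists (Max_index Aloc); split.
  split; first exact: Max_index_continuous.
  exists (Max_point Aloc); split; first exact: Max_indexK.
    exact: Max_pointK.
  exact: Max_point_continuous.
move=> M; split=> [MN x|Minf_M].
  by rewrite -(Max_indexK Aloc M) MN.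
apply: (Max_point_inj (Aloc := Aloc)); rewrite Max_indexK; apply: val_inj.
exact: Spec_eq.
Qed.
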